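(* Let $\pi_\theta^{\mathrm{mix}}$ be the mixed policy that follows the main policy $\pi_\theta$ at states in the safe region $\mathcal R(d_{\max})$ and a $\theta$-independent recovery policy $\pi^{\mathrm{rec}}$ at states outside it, and let $J(\theta)$, $J^{\mathrm{mix}}(\theta)$ be the expected discounted returns of $\pi_\theta$ and $\pi_\theta^{\mathrm{mix}}$. (Exact, R-A.) If $\mathcal R(d_{\max})$ covers the reachable state space, i.e. $\mathcal S_{\mathrm{reach}}\subseteq\mathcal R(d_{\max})$, then $\pi_\theta$ and $\pi_\theta^{\mathrm{mix}}$ coincide on the reachable support of the main-policy trajectory law $p_\theta$ (that is, $p_\theta$-almost surely, $\pi_\theta(\cdot\mid s_t)=\pi_\theta^{\mathrm{mix}}(\cdot\mid s_t)$ for all $t$), $\beta(\theta,d_{\max})=0$, and $J^{\mathrm{mix}}(\theta)=J(\theta)$. (Approximate, R-B.) Otherwise, suppose that the initial state distribution is supported in $\mathcal R(d_{\max})$, and let $\eta_\star=\eta(\theta,d_{\max})\ge0$ be an invariance slack of $\mathcal R(d_{\max})$ under $\pi_\theta$, i.e. for every reachable $s\in\mathcal R(d_{\max})$, the next state under $a\sim\pi_\theta(\cdot\mid s)$, $s'\sim P(\cdot\mid s,a)$ satisfies $\Pr[s'\in\mathcal R(d_{\max})]\ge1-\eta_\star$ (uniformly over time). Then $$|J(\theta)-J^{\mathrm{mix}}(\theta)|\le\frac{2\,r_{\max}\,\eta_\star}{(1-\gamma)^3}.$$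
   Context: Setting: an infinite-horizon discounted Markov decision process with measurable state space $\mathcal S$ and measurable action space $\mathcal A$, initial state distribution $p$, transition kernel $P(\cdot\mid s,a)$, measurable reward $r(s,a)\in[-r_{\max},r_{\max}]$ and discount $\gamma\in(0,1)$. (Episode termination at failure states is modelled by absorption.) Policies are probability kernels from $\mathcal S$ to $\mathcal A$. The safe region is $\mathcal R(d)=\{s:\mathcal D(s)\le d\}$ for a measurable function $\mathcal D:\mathcal S\to[0,\infty)$, with $d\in[0,d_{\max}]$; here $d=d_{\max}$. $\pi_\theta^{\mathrm{mix}}(\cdot\mid s)$ equals $\pi_\theta(\cdot\mid s)$ if $s\in\mathcal R(d_{\max})$ and $\pi^{\mathrm{rec}}(\cdot\mid s)$ otherwise. The reachable state space $\mathcal S_{\mathrm{reach}}$ is a measurable subset of $\mathcal S$ with $p(\mathcal S_{\mathrm{reach}})=1$ and $P(\mathcal S_{\mathrm{reach}}\mid s,a)=1$ for all $s\in\mathcal S_{\mathrm{reach}}$ and $a\in\mathcal A$ (so that trajectories remain in it almost surely under any action distribution); a state is called reachable if it lies in $\mathcal S_{\mathrm{reach}}$. Index time from $0$ with $s_0\sim p$. $p_\theta$ and $p_\theta^{\mathrm{mix}}$ are the laws of $(s_t,a_t)_{t\ge0}$ under $\pi_\theta$ and $\pi_\theta^{\mathrm{mix}}$. $J(\theta)=\mathbb E_{p_\theta}[\sum_{t\ge0}\gamma^t r(s_t,a_t)]$ and $J^{\mathrm{mix}}(\theta)=\mathbb E_{p_\theta^{\mathrm{mix}}}[\sum_{t\ge0}\gamma^t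 r(s_t,a_t)]$. The out-of-region rate is $\beta(\theta,d)=(1-\gamma)\sum_{t\ge0}\gamma^t\Pr_{p_\theta}[s_t\notin\mathcal R(d)]$. *)

(* Defs.v *)
From HB Require Import structures.
From mathcomp Require Import all_boot all_order all_algebra.
From mathcomp Require Import all_classical all_reals all_analysis.
From mathcomp Require Import measurable_realfun.

Set Implicit Arguments.
Unset Strict Implicit.
Unset Printing Implicit Defensive.

Import Order.TTheory GRing.Theory Num.Theory.
Import numFieldNormedType.Exports.

Local Open Scope classical_set_scope.
Local Open Scope ring_scope.
Local Open Scope ereal_scope.

Section trajectory_space.
Context (dS dA : measure_display).
Context (S : measurableType dS) (A : measurableType dA).

(* The product sigma-algebra on (S * A)^nat, i.e. the smallest one making
   every coordinate w |-> w t = (s_t, a_t) measurable. *)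
Definition trajectory : Type :=
  g_sigma_algebraType
    (\bigcup_(t in [set: nat])
       preimage_set_system setT (fun w : nat -> S * A => w t) measurable).

HB.instance Definition _ := Measurable.on trajectory.

Definition state_at (t : nat) (w : trajectory) : S :=
  (w t : (S * A)%type).1.
Definition action_at (t : nat) (w : trajectory) : A :=
  (w t : (S * A)%type).2.

End trajectory_space.

Section mdp.
Context (dS dA : measure_display).
Context (S : measurableType dS) (A : measurableType dA) (R : realType).

(* Probability, starting from s_0 = s, that s_t \in B t and a_t \in C t for
   all t < n:
     1_(B 0)(s) \int_(C 0) pi(da_0|s) \int P(ds_1|s,a_0) 1_(B 1)(s_1) ...  *)
Fixpoint cylinder_prob (pi : S -> {measure set A -> \bar R})
    (P : S * A -> {measure set S -> \bar R}) (n : nat)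
    (B : nat -> set S) (C : nat -> set A) (s : S) : \bar R :=
  if n is m.+1 then
    (\1_(B 0%N) s)%:E *
    \int[pi s]_(a in C 0%N) \int[P (s, a)]_s'
      cylinder_prob pi P m (fun t => B t.+1) (fun t => C t.+1) s'
  else 1.

(* mu is the law of (s_t, a_t)_t when s_0 ~ p, a_t ~ pi(.|s_t) and
   s_(t+1) ~ P(.|s_t, a_t).  The cylinders form a pi-system generating the
   sigma-algebra of trajectory, so mu is unique; it exists by the
   Ionescu-Tulcea theorem. *)
Definition is_trajectory_law (p : probability S R)
    (P : R.-pker (S * A) ~> S) (pi : R.-pker S ~> A)
    (mu : probability (trajectory S A) R) : Prop :=
  forall (n : nat) (B : nat -> set S) (C : nat -> set A),
    (forall t, measurable (B t)) -> (forall t, measurable (C t)) ->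
    mu [set w | forall t, (t < n)%N -> B t (state_at t w) /\ C t (action_at t w)]
    = \int[p]_s cylinder_prob pi P n B C s.

Definition safe_region (D : S -> R) (d : R) : set S := [set s | (D s <= d)%R].

Lemma measurable_safe_region (D : {mfun S >-> R}) (d : R) :
  measurable (safe_region D d).
Proof.
rewrite (_ : safe_region D d = D @^-1` `]-oo, d]).
  by rewrite -[X in measurable X]setTI; exact: measurable_funP.
by apply/seteqP; split=> s; rewrite /safe_region /= in_itv.
Qed.

Section mixed_policy.
Context (D : {mfun S >-> R}) (d : R) (pi pi_rec : R.-pker S ~> A).

Definition mixed_policy : S -> {measure set A -> \bar R} :=
  fun s => if s \in safe_region D d then pi s else pi_rec s.

Let measurable_mixed_policy U :
  measurable U -> measurable_fun [set: S] (mixed_policy ^~ U).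
Proof.
move=> mU; rewrite (_ : mixed_policy ^~ U =
  fun s => if s \in safe_region D d then pi s U else pi_rec s U); last first.
  by apply/funext => s; rewrite /mixed_policy; case: ifP.
apply: measurable_fun_if => //.
- apply: (measurable_fun_bool true); rewrite setTI.
  rewrite (_ : _ @^-1` _ = safe_region D d); first exact: measurable_safe_region.
  by apply/seteqP; split=> s /=; [move/set_mem|move/mem_set].
- exact/measurable_funTS/measurable_kernel.
- exact/measurable_funTS/measurable_kernel.
Qed.

HB.instance Definition _ :=
  isKernel.Build _ _ S A R mixed_policy measurable_mixed_policy.

Let mixed_policy_prob s : mixed_policy s [set: A] = 1.
Proof. by rewrite /mixed_policy; case: ifP => _; exact: prob_kernel. Qed.

HB.instance Definition _ :=
  Kernel_isProbability.Build _ _ S A R mixed_policy mixed_policy_prob.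

End mixed_policy.

Definition is_reachable_space (p : probability S R) (P : R.-pker (S * A) ~> S)
    (Sreach : set S) : Prop :=
  [/\ measurable Sreach, p Sreach = 1
    & forall s a, Sreach s -> P (s, a) Sreach = 1].

Definition discounted_return (gamma : R) (r : S * A -> R)
    (w : trajectory S A) : R :=
  limn (series (fun t => gamma ^+ t * r (state_at t w, action_at t w))%R).

Definition expected_return (gamma : R) (r : S * A -> R)
    (mu : probability (trajectory S A) R) : \bar R :=
  'E_mu[discounted_return gamma r].

Definition out_of_region_rate (gamma : R) (D : S -> R)
    (mu : probability (trajectory S A) R) (d : R) : \bar R :=
  (1 - gamma)%:E *
  \sum_(0 <= t <oo)
    ((gamma ^+ t)%:E * mu [set w | ~ safe_region D d (state_at t w)]).

(* (pi \; P) s is the law of the next state s' from s, with a ~ pi(.|s) and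
   s' ~ P(.|s, a). *)
Definition is_invariance_slack (P : R.-pker (S * A) ~> S) (Sreach : set S)
    (D : S -> R) (d : R) (pi : R.-pker S ~> A) (eta : R) : Prop :=
  forall s, Sreach s -> safe_region D d s ->
    (1 - eta)%:E <= (pi \; P) s (safe_region D d).

End mdp.

(* Main.v *)
(* Let G be the reachable part of the safe region.  The two policies agree on
   G, so the two trajectory laws give the same mass to every event about
   (s_t, a_t) intersected with {s_0, ..., s_t in G}: this holds on cylinders by
   their iterated-integral formula, and on all events by a pi-system argument.
   The slack condition and a union bound over time show that this stay event
   fails with probability at most t * eta, hence the expected rewards at time t
   differ by at most 2 * r_max * t * eta.  Summing against gamma^t gives
   2 * r_max * eta * gamma / (1 - gamma)^2, which is below the claimed bound.
   If the safe region contains the reachable states, eta = 0 is a slack. *)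
Require Import Defs.
From HB Require Import structures.
From mathcomp Require Import all_boot all_order all_algebra.
From mathcomp Require Import all_classical all_reals all_analysis.
From mathcomp Require Import measurable_realfun ring lra.

Set Implicit Arguments.
Unset Strict Implicit.
Unset Printing Implicit Defensive.

Import Order.TTheory GRing.Theory Num.Theory.
Import numFieldNormedType.Exports.
Local Open Scope classical_set_scope.
Local Open Scope ring_scope.
Local Open Scope ereal_scope.

(** * Expectations under two laws that agree on an event *)

(* phi has the same law under mu and nu when restricted to E, so expectations
   of f \o phi differ only through the complement of E. *)
Section coupling.
Context d d' (T : measurableType d) (U : measurableType d') (R : realType).
Context (mu nu : probability T R) (phi : T -> U) (E : set T) (f : U -> R) (M : R).
Hypotheses (mphi : measurable_fun [set: T] phi) (mE : measurable E).
Hypotheses (mf : measurable_fun [set: U] f) (fM : forall u, (`|f u| <= M)%R).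

Lemma bounded_comp_integrable (m : {measure set T -> \bar R}) (D : set T) :
  measurable D -> m D < +oo -> m.-integrable D (fun w => (f (phi w))%:E).
Proof.
move=> mD mDoo; apply: (@measurable_bounded_integrable _ _ _ _ (f \o phi)) => //.
- exact: measurable_funTS (measurableT_comp mf mphi).
- exists M; split; first exact: num_real.
  by move=> x Mx w _ /=; apply: le_trans (fM _) (ltW Mx).
Qed.

Lemma probability_lty (m : probability T R) (D : set T) :
  measurable D -> m D < +oo.
Proof. by move=> mD; exact: le_lt_trans (probability_le1 _ mD) (ltry _). Qed.

Lemma abse_integral_comp_le (m : probability T R) (D : set T) :
  measurable D -> `|\int[m]_(w in D) (f (phi w))%:E| <= M%:E * m D.
Proof.
move=> mD; have intf := bounded_comp_integrable mD (probability_lty m mD).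
apply: le_trans (le_abse_integral _ mD (measurable_int _ intf)) _.
rewrite -integral_cst//; apply: ge0_le_integral => //.
- exact: measurableT_comp (measurable_int _ intf).
- by move=> w _; rewrite /= lee_fin.
Qed.

(** The restricted measure ignores the complement of [E]; an integral over the whole space is what
    the change of variables along [phi] needs. *)
Lemma integral_mrestr (m : probability T R) :
  \int[m]_(w in E) (f (phi w))%:E = \int[mrestr m mE]_w (f (phi w))%:E.
Proof.
transitivity (\int[mrestr m mE]_(w in E) (f (phi w))%:E).
  by apply: eq_measure_integral => X mX XE; rewrite /= /mrestr setIidl.
rewrite [RHS](@negligible_integral _ _ _ _ _ (~` E)) ?setTD ?setCK//.
- exact: measurableC.
- apply: bounded_comp_integrable => //.
  by rewrite /= /mrestr setTI; exact: probability_lty.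
- by rewrite /= /mrestr setICl measure0.
Qed.

Hypothesis agree : forall X, measurable X ->
  mu (E `&` phi @^-1` X) = nu (E `&` phi @^-1` X).

Lemma integral_agree :
  \int[mu]_(w in E) (f (phi w))%:E = \int[nu]_(w in E) (f (phi w))%:E.
Proof.
have push (m : probability T R) : \int[m]_(w in E) (f (phi w))%:E =
    \int[pushforward (mrestr m mE) phi]_u (f u)%:E.
  rewrite integral_mrestr (integral_pushforward mphi)//.
  - exact/measurable_EFinP.
  - rewrite preimage_setT; apply: bounded_comp_integrable => //.
    by rewrite /= /mrestr setTI; exact: probability_lty.
rewrite !push; apply: eq_measure_integral => X mX _.
by rewrite /= /pushforward /= /mrestr !(setIC _ E) agree.
Qed.

(** The integrals over [E] cancel. Each law contributes at most [M * e] on the complement, hence the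
    factor 2. *)
Lemma coupling_integral_le (e : R) :
  mu (~` E) <= e%:E -> nu (~` E) <= e%:E ->
  `|\int[mu]_w (f (phi w))%:E - \int[nu]_w (f (phi w))%:E| <= (2 * M * e)%:E.
Proof.
move=> mue nue.
have mEC : measurable (~` E) by exact: measurableC.
have M0 : (0 <= M)%R by exact: le_trans (normr_ge0 _) (fM (phi point)).
have split_int (m : probability T R) : \int[m]_w (f (phi w))%:E =
    \int[m]_(w in E) (f (phi w))%:E + \int[m]_(w in ~` E) (f (phi w))%:E.
  rewrite -integral_setU ?setUv//.
  - exact: measurable_int (bounded_comp_integrable measurableT (probability_lty m measurableT)).
  - by apply/disj_setPS => w [].
have tail (m : probability T R) : m (~` E) <= e%:E ->
    `|\int[m]_(w in ~` E) (f (phi w))%:E| <= (M * e)%:E.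
  move=> me; apply: le_trans (abse_integral_comp_le m mEC) _.
  by rewrite EFinM lee_wpmul2l// lee_fin.
have fin (m : probability T R) D : measurable D ->
    \int[m]_(w in D) (f (phi w))%:E \is a fin_num.
  by move=> mD; exact: integrable_fin_num (bounded_comp_integrable mD (probability_lty m mD)).
rewrite !split_int integral_agree.
have := tail _ mue; have := tail _ nue.
rewrite -(fineK (fin nu _ mE)) -(fineK (fin nu _ mEC)) -(fineK (fin mu _ mEC)).
rewrite -!EFinD !abse_EFin !lee_fin => h1 h2.
rewrite opprD addrACA subrr add0r.
apply: le_trans (ler_normB _ _) _.
by rewrite -mulrA mulr_natl mulr2n lerD.
Qed.
End coupling.

(** * Cylinder probabilities and agreement of trajectory laws *)

Section trajectory_laws.
Context dS dA (S : measurableType dS) (A : measurableType dA) (R : realType).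

Lemma measurable_coordinate (t : nat) :
  measurable_fun [set: trajectory S A] (fun w : trajectory S A => (w t : S * A)).
Proof.
move=> _ X mX; apply: sub_gen_smallest; exists t => //.
by exists X.
Qed.

Lemma measurable_state_at (t : nat) :
  measurable_fun [set: trajectory S A] (@state_at _ _ S A t).
Proof. exact: measurableT_comp measurable_fst (measurable_coordinate t). Qed.

Definition stays (G : set S) (n : nat) : set (trajectory S A) :=
  [set w | forall t, (t < n)%N -> G (state_at t w)].

Lemma measurable_stays (G : set S) (n : nat) :
  measurable G -> measurable (stays G n).
Proof.
move=> mG; rewrite (_ : stays G n =
    \bigcap_(t in [set t | (t < n)%N]) (@state_at _ _ S A t @^-1` G)); last first.
  by apply/seteqP; split=> w h t; exact: h.
apply: bigcap_measurableType => t _.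
by rewrite -[X in measurable X]setTI; exact: measurable_state_at.
Qed.

Lemma cylinder_prob_ge0 (pi : S -> {measure set A -> \bar R})
    (P : S * A -> {measure set S -> \bar R}) n B C s :
  0 <= cylinder_prob pi P n B C s.
Proof.
elim: n B C s => [|n IH] B C s //=.
apply: mule_ge0; first by rewrite lee_fin.
by apply: integral_ge0 => a _; exact: integral_ge0.
Qed.

Lemma measurable_cylinder_prob (pi : R.-pker S ~> A) (P : R.-pker (S * A) ~> S)
    n B C :
  (forall t, measurable (B t)) -> (forall t, measurable (C t)) ->
  measurable_fun [set: S] (cylinder_prob pi P n B C).
Proof.
elim: n B C => [|n IH] B C mB mC //=.
apply: emeasurable_funM.
  by apply/measurable_EFinP; exact: measurable_indic.
(* The domain [C 0] becomes an indicator factor, so that [g] is jointly measurable in state and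
   action and is integrated over all actions. *)
pose g (sa : S * A) := \int[P sa]_s' cylinder_prob pi P n
  (fun t => B t.+1) (fun t => C t.+1) s' * (\1_(C 0%N) sa.2)%:E.
have g_ge0 sa : 0 <= g sa.
  apply: mule_ge0; last by rewrite lee_fin.
  by apply: integral_ge0 => *; exact: cylinder_prob_ge0.
have mg : measurable_fun [set: S * A] g.
  apply: emeasurable_funM.
    apply: measurable_fun_integral_kernel => //.
    - by move=> U mU; exact: measurable_kernel.
    - by move=> z; exact: cylinder_prob_ge0.
    - exact: IH.
  apply/measurable_EFinP.
  by apply: (measurableT_comp (measurable_indic _)).
apply: eq_measurable_fun (measurable_fun_integral_finite_kernel g pi g_ge0 mg).
move=> s _; rewrite [RHS]integral_mkcond; apply: eq_integral => a _.
by rewrite /g patchE indicE; case: ifP => _; rewrite ?mule1 ?mule0.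
Qed.

(** The policy at time [t] only matters at states of [B t]: elsewhere the indicator in front of the
    integral vanishes. *)
Lemma eq_cylinder_prob (pi1 pi2 : S -> {measure set A -> \bar R})
    (P : S * A -> {measure set S -> \bar R}) n B C s :
  (forall t s', (t < n)%N -> B t s' -> pi1 s' = pi2 s') ->
  cylinder_prob pi1 P n B C s = cylinder_prob pi2 P n B C s.
Proof.
elim: n B C s => [|n IH] B C s h //=.
have [Bs|nBs] := pselect (B 0%N s); last first.
  by rewrite indicE memNset// !mul0e.
rewrite (h 0%N s erefl Bs); congr mule.
apply: eq_integral => a _; apply: eq_integral => s' _.
by apply: IH => t s'' tn; exact: h.
Qed.

Context (p : probability S R) (P : R.-pker (S * A) ~> S).

(** Staying in [G] through time [t] with a rectangle constraint at time [t] is itself a cylinder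
    event. *)
Lemma law_stays_rect (pi : R.-pker S ~> A) (mu : probability (trajectory S A) R)
    (G X : set S) (Y : set A) t :
  is_trajectory_law p P pi mu ->
  measurable G -> measurable X -> measurable Y ->
  mu (stays G t.+1 `&` (fun w : trajectory S A => (w t : S * A)) @^-1` (X `*` Y)) =
  \int[p]_s cylinder_prob pi P t.+1
    (fun i => if i == t then G `&` X else G)
    (fun i => if i == t then Y else [set: A]) s.
Proof.
move=> hmu mG mX mY; rewrite -hmu; last first.
- by move=> i; case: ifP.
- by move=> i; case: ifP => // _; exact: measurableI.
congr (mu _); apply/seteqP; split=> w /=.
- move=> [Gw [Xw Yw]] i it; have Gi := Gw _ it.
  by case: eqP => [->|//]; split=> //; split=> //; exact: Gw.
- move=> h; split.
    by move=> i it; have [] := h _ it; case: eqP => [->|_] // [].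
  by have [] := h t (ltnSn t); rewrite eqxx => -[].
Qed.

(** Rectangles form a pi-system generating the product sigma-algebra. On a rectangle both masses are
    integrals of cylinder probabilities whose state sets all lie in [G], where the policies agree;
    finiteness of the measures then gives uniqueness. *)
Lemma law_stays_agree (pi1 pi2 : R.-pker S ~> A)
    (mu1 mu2 : probability (trajectory S A) R) (G : set S) t X :
  is_trajectory_law p P pi1 mu1 -> is_trajectory_law p P pi2 mu2 ->
  measurable G -> (forall s, G s -> pi1 s = pi2 s) -> measurable X ->
  mu1 (stays G t.+1 `&` (fun w : trajectory S A => (w t : S * A)) @^-1` X) =
  mu2 (stays G t.+1 `&` (fun w : trajectory S A => (w t : S * A)) @^-1` X).
Proof.
move=> h1 h2 mG eqpi mX.
have mE := measurable_stays t.+1 mG.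
pose mphi := measurable_coordinate t.
pose phi_mixin := isMeasurableFun.Build _ _ _ _ _ mphi.
pose phi : {mfun trajectory S A >-> (S * A)%type} :=
  MeasurableFun.Pack (MeasurableFun.Class phi_mixin).
rewrite !(setIC (stays G t.+1)).
apply: (@measure_unique _ R (S * A)%type
  [set X `*` Y | X in measurable & Y in measurable] (fun=> setT)
  (measurable_prod_measurableType S A) _ _ _
  (pushforward (mrestr mu1 mE) phi) (pushforward (mrestr mu2 mE) phi)) => //.
- move=> _ _ [X1 mX1 [Y1 mY1 <-]] [X2 mX2 [Y2 mY2 <-]].
  rewrite -setXI; exists (X1 `&` X2); first exact: measurableI.
  by exists (Y1 `&` Y2) => //; exact: measurableI.
- by move=> _; exists setT => //; exists setT => //; rewrite setXTT.
- by rewrite bigcup_const.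
- move=> _ [X1 mX1 [Y1 mY1 <-]].
  rewrite /= /pushforward /mrestr !(setIC _ (stays G t.+1)).
  rewrite (law_stays_rect _ h1)// (law_stays_rect _ h2)//.
  apply: eq_integral => s _; apply: eq_cylinder_prob => i s' _.
  by case: ifP => _ => [[Gs' _]|Gs']; exact: eqpi.
- move=> _; rewrite /= /pushforward /mrestr preimage_setT setTI.
  exact: probability_lty.
Qed.

End trajectory_laws.

(** * Probability of leaving an almost invariant set *)

Section invariance.
Context dS dA (S : measurableType dS) (A : measurableType dA) (R : realType).
Context (p : probability S R) (P : R.-pker (S * A) ~> S) (pi : R.-pker S ~> A).

Lemma integralD_cst d (T : measurableType d) (m : {measure set T -> \bar R})
    (h : T -> \bar R) (k : R) :
  m [set: T] = 1 -> measurable_fun [set: T] h -> (forall x, 0 <= h x) ->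
  (0 <= k)%R -> \int[m]_x (h x + k%:E) = \int[m]_x h x + k%:E.
Proof.
move=> m1 mh h0 k0; rewrite ge0_integralD//.
by rewrite integral_cst// m1 mule1.
Qed.

Lemma measurable_integral_kernel_pair (s : S) (h : S -> \bar R) :
  measurable_fun [set: S] h -> (forall x, 0 <= h x) ->
  measurable_fun [set: A] (fun a => \int[P (s, a)]_s' h s').
Proof.
move=> mh h0; apply: measurable_fun_integral_kernel => // U mU.
exact: measurableT_comp (measurable_kernel P U mU) (measurable_pair1 s).
Qed.

(* The error n * eta stands on the right because 1 - n * eta may be negative,
   while the integrands should stay nonnegative. *)
Lemma cylinder_prob_slack (G : set S) (eta : R) n s :
  measurable G -> (0 <= eta)%R ->
  (forall s, G s -> 1 <= (pi \; P) s G + eta%:E) ->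
  (\1_G s)%:E <= cylinder_prob pi P n.+1 (fun=> G) (fun=> setT) s + (n%:R * eta)%:E.
Proof.
move=> mG eta0 slack; elim: n s => [|n IH] s.
  (* One state involves no transition, so the error is zero and the cylinder probability is exactly
     the indicator. *)
  rewrite mul0r adde0 /= [X in _ <= _ * X](_ : _ = 1) ?mule1//.
  under eq_integral => a _ do
    rewrite (_ : \int[P (s, a)]__ 1 = 1) ?integral_cst ?mul1e ?prob_kernel//.
  by rewrite integral_cst// mul1e prob_kernel.
pose c := cylinder_prob pi P n.+1 (fun=> G) (fun=> setT).
rewrite -[cylinder_prob _ _ _ _ _ s]/((\1_G s)%:E * \int[pi s]_a \int[P (s, a)]_s' c s').
have mc : measurable_fun [set: S] c by exact: measurable_cylinder_prob.
have c0 x : 0 <= c x by exact: cylinder_prob_ge0.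
have k0 : (0 <= n%:R * eta)%R by rewrite mulr_ge0.
have [Gs|nGs] := pselect (G s); last first.
  by rewrite indicE memNset// mul0e add0e lee_fin mulr_ge0.
(* One [eta] pays for the first transition through the slack; the remaining [n * eta] is moved
   inside both integrals, where the induction hypothesis applies pointwise. *)
rewrite indicE mem_set// mul1e -natr1 mulrDl mul1r EFinD addeA.
apply: le_trans (slack _ Gs) _; rewrite leeD2r//.
rewrite -integralD_cst//; last 3 first.
- exact: prob_kernel.
- exact: measurable_integral_kernel_pair.
- by move=> a; exact: integral_ge0.
rewrite /= /kcomp; apply: ge0_le_integral => //.
- exact: measurableT_comp (measurable_kernel P G mG) (measurable_pair1 s).
- by apply: emeasurable_funD => //; exact: measurable_integral_kernel_pair.
move=> a _; rewrite -integralD_cst//; last exact: prob_kernel.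
have -> : P (s, a) G = \int[P (s, a)]_s' (\1_G s')%:E.
  by rewrite integral_indic// setIT.
apply: ge0_le_integral => //.
- by apply/measurable_EFinP; exact: measurable_indic.
- exact: emeasurable_funD.
Qed.

(** The initial state is in [G] almost surely, so staying for [n.+1] states risks only [n]
    transitions. Integrating the pointwise slack estimate against [p] gives the bound. *)
Lemma probability_stays (mu : probability (trajectory S A) R) (G : set S) (eta : R) n :
  is_trajectory_law p P pi mu -> measurable G -> p G = 1 -> (0 <= eta)%R ->
  (forall s, G s -> 1 <= (pi \; P) s G + eta%:E) ->
  mu (~` stays G n.+1) <= (n%:R * eta)%:E.
Proof.
move=> hmu mG pG eta0 slack.
have mE := measurable_stays (A := A) n.+1 mG.
have : 1 <= mu (stays G n.+1) + (n%:R * eta)%:E.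
  rewrite (_ : stays G n.+1 = [set w | forall t, (t < n.+1)%N ->
      G (state_at t w) /\ [set: A] (action_at t w)]); last first.
    apply/seteqP; split=> w h t tn; first by split=> //; exact: h.
    by have [] := h t tn.
  rewrite (hmu n.+1 (fun=> G) (fun=> setT))//.
  rewrite -integralD_cst//; last 4 first.
  - exact: probability_setT.
  - exact: measurable_cylinder_prob.
  - by move=> x; exact: cylinder_prob_ge0.
  - by rewrite mulr_ge0.
  rewrite -[X in X <= _]pG -[X in p X]setIT -integral_indic//.
  apply: ge0_le_integral => //.
  - by apply/measurable_EFinP; exact: measurable_indic.
  - by apply: emeasurable_funD => //; exact: measurable_cylinder_prob.
  - by move=> s _; exact: cylinder_prob_slack.
rewrite probability_setC// => h.
by rewrite leeBlDl ?fin_num_measure.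
Qed.

End invariance.

(** * Discounted sums and expected returns *)

Lemma sum_geometric_nat_le (R : realType) (gamma : R) (n : nat) :
  (0 < gamma < 1)%R ->
  (\sum_(0 <= t < n) gamma ^+ t * t%:R <= ((1 - gamma) ^+ 3)^-1)%R.
Proof.
move=> /andP[g0 g1].
(* Dropping the nonnegative subtracted term bounds the sum by [gamma / (1 - gamma) ^ 2]; the cube
   then follows from [gamma * (1 - gamma) <= 1]. *)
have closed m : ((1 - gamma) ^+ 2 * \sum_(0 <= t < m) gamma ^+ t * t%:R =
    gamma - gamma ^+ m * (gamma + m%:R * (1 - gamma)))%R.
  elim: m => [|m IH]; first by rewrite big_nil mulr0 expr0 mul0r addr0 mul1r subrr.
  by rewrite big_nat_recr//= mulrDr IH (exprS gamma) -natr1; ring.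
have h0 : (0 < 1 - gamma)%R by rewrite subr_gt0.
rewrite -(ler_pM2l (exprn_gt0 3 h0)) divff ?gt_eqF ?exprn_gt0//.
rewrite exprS -mulrA closed.
have : (0 <= gamma ^+ n * (gamma + n%:R * (1 - gamma)))%R.
  by rewrite mulr_ge0 ?exprn_ge0 ?addr_ge0 ?mulr_ge0 ?ler0n// ltW.
by nra.
Qed.

Section expected_returns.
Context dS dA (S : measurableType dS) (A : measurableType dA) (R : realType).
Context (gamma M : R) (r : {mfun (S * A)%type >-> R}).
Hypotheses (hgamma : (0 < gamma < 1)%R) (rM : forall x, (`|r x| <= M)%R).

(** The reward is applied to the coordinate [w t] as a whole, to fit the coupling estimate with
    [phi] the coordinate map. *)
Let partial_return (n : nat) (w : trajectory S A) : R :=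
  (\sum_(0 <= t < n) gamma ^+ t * r (w t : S * A))%R.

Let normr_gamma : (`|gamma| < 1)%R.
Proof. by have /andP[g0 g1] := hgamma; rewrite gtr0_norm. Qed.

Let bound_ge0 : (0 <= M)%R.
Proof. exact: le_trans (normr_ge0 _) (rM point). Qed.

Lemma partial_return_le n w : (`|partial_return n w| <= M / (1 - gamma))%R.
Proof.
have /andP[g0 _] := hgamma.
apply: le_trans (ler_norm_sum _ _ _) _.
apply: le_trans (geometric_le_lim n bound_ge0 g0 normr_gamma).
rewrite /series /=; apply: ler_sum => t _.
by rewrite normrM normrX (gtr0_norm g0) mulrC ler_wpM2r// exprn_ge0// ltW.
Qed.

(** Comparison with a geometric series; convergence is what makes the [limn] in [discounted_return]
    a genuine sum. *)
Lemma cvg_partial_return w :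
  partial_return n w @[n --> \oo] --> discounted_return gamma r w.
Proof.
have -> : discounted_return gamma r w = limn (fun n => partial_return n w).
  rewrite /discounted_return /partial_return /series; congr (limn _).
  apply/funext => n; apply: eq_bigr => t _; congr (_ * r _)%R.
  by rewrite /state_at /action_at -surjective_pairing.
apply: (@normed_cvg _ R^o (fun t => gamma ^+ t * r (w t : S * A))%R).
apply: series_le_cvg (@is_cvg_geometric_series _ M gamma normr_gamma).
- by move=> t /=.
- by move=> t /=; rewrite mulr_ge0 ?bound_ge0 ?exprn_ge0// ltW//; case/andP: hgamma.
- move=> t /=; have /andP[g0 _] := hgamma.
  by rewrite normrM normrX (gtr0_norm g0) mulrC ler_wpM2r// exprn_ge0// ltW.
Qed.

Lemma measurable_reward t :
  measurable_fun [set: trajectory S A] (fun w => r (w t : S * A)).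
Proof. exact: measurableT_comp (measurable_funPT r) (measurable_coordinate t). Qed.

Lemma measurable_partial_return n : measurable_fun setT (partial_return n).
Proof.
apply: measurable_sum => t.
by apply: measurable_funM => //; exact: measurable_reward.
Qed.

(** Dominated convergence with the constant bound [M / (1 - gamma)]. *)
Lemma cvg_expected_return (mu : probability (trajectory S A) R) :
  expected_return gamma r mu \is a fin_num /\
  \int[mu]_w (partial_return n w)%:E @[n --> \oo] --> expected_return gamma r mu.
Proof.
have [|||||intf _ cvgf] := @dominated_convergence _ _ _ mu setT measurableT
    (fun n w => (partial_return n w)%:E)
    (fun w => (discounted_return gamma r w)%:E) (cst (M / (1 - gamma))%:E).
- by move=> n; apply/measurable_EFinP; exact: measurable_partial_return.
- apply/measurable_EFinP; apply: measurable_fun_cvg measurable_partial_return _.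
  by move=> w _; exact: cvg_partial_return.
- apply: aeW => w _; apply: cvg_EFin; last exact: cvg_partial_return.
  exact: nearW.
- exact: finite_measure_integrable_cst.
- by apply: aeW => w n _; rewrite abse_EFin lee_fin; exact: partial_return_le.
rewrite /expected_return unlock; split=> //.
exact: integrable_fin_num.
Qed.

Lemma integral_partial_return (mu : probability (trajectory S A) R) n :
  \int[mu]_w (partial_return n w)%:E =
  \sum_(0 <= t < n) (gamma ^+ t)%:E * \int[mu]_w (r (w t : S * A))%:E.
Proof.
have intr t : mu.-integrable setT (fun w : trajectory S A => (r (w t : S * A))%:E).
  apply: (bounded_comp_integrable (measurable_coordinate t) _ rM) => //.
  exact: probability_lty.
rewrite /partial_return.
under eq_integral => w _ do rewrite -sumEFin.
rewrite integral_sum//; last first.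
  by move=> t; exact: (integrableZl measurableT (gamma ^+ t) (intr t)).
apply: eq_bigr => t _; under eq_integral do rewrite EFinM.
by rewrite integralZl.
Qed.

(** The weighted sum of the per-time errors is bounded uniformly in the horizon, so the bound
    survives the limit. *)
Lemma expected_return_le (mu nu : probability (trajectory S A) R) (e : R) :
  (0 <= e)%R ->
  (forall t, `|\int[mu]_w (r (w t : S * A))%:E - \int[nu]_w (r (w t : S * A))%:E|
     <= (2 * M * (t%:R * e))%:E) ->
  `|expected_return gamma r mu - expected_return gamma r nu| <=
  (2 * M * e / (1 - gamma) ^+ 3)%:E.
Proof.
move=> e0 close; have [mufin mucvg] := cvg_expected_return mu.
have [nufin nucvg] := cvg_expected_return nu.
have dcvg : `|\int[mu]_w (partial_return n w)%:E - \int[nu]_w (partial_return n w)%:E|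
    @[n --> \oo] --> `|expected_return gamma r mu - expected_return gamma r nu|.
  by apply: cvg_abse; apply: cvgeB => //; exact: fin_num_adde_defr.
rewrite -(cvg_lim _ dcvg)//; apply: lime_le; first exact: cvgP dcvg.
apply: nearW => n /=.
have fin (m : probability (trajectory S A) R) t :
    \int[m]_w (r (w t : S * A))%:E \is a fin_num.
  apply: integrable_fin_num => //.
  apply: (bounded_comp_integrable (measurable_coordinate t) _ rM) => //.
  exact: probability_lty.
rewrite !integral_partial_return.
(* All integrals are finite, so the difference of sums can be computed in [R]. *)
under eq_bigr => t _ do rewrite -(fineK (fin mu t)) -EFinM.
under [X in _ - X]eq_bigr => t _ do rewrite -(fineK (fin nu t)) -EFinM.
rewrite !sumEFin -EFinB abse_EFin lee_fin -sumrB.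
apply: le_trans (ler_norm_sum _ _ _) _.
apply: (@le_trans _ _ (\sum_(0 <= t < n) (2 * M * e) * (gamma ^+ t * t%:R))%R).
  apply: ler_sum => t _; have := close t.
  rewrite -(fineK (fin mu t)) -(fineK (fin nu t)) -EFinB abse_EFin lee_fin => h.
  have /andP[g0 _] := hgamma.
  rewrite -mulrBr normrM normrX (gtr0_norm g0).
  apply: le_trans (ler_wpM2l (exprn_ge0 t (ltW g0)) h) _.
  by rewrite le_eqVlt; apply/orP; left; apply/eqP; ring.
rewrite -mulr_sumr ler_wpM2l ?sum_geometric_nat_le//.
by rewrite !mulr_ge0 ?bound_ge0.
Qed.

End expected_returns.

(** * Comparison of the main and mixed policies *)

Lemma measureI_full d (T : measurableType d) (R : realType)
    (m : {measure set T -> \bar R}) (X Y : set T) :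
  measurable X -> measurable Y -> m [set: T] = 1 -> m Y = 1 ->
  m (X `&` Y) = m X.
Proof.
move=> mX mY mT mY1.
have mC0 : m (~` Y) = 0.
  have : m setT = m (setT `\` Y) + m (setT `&` Y) by exact: measureDI.
  rewrite setTD setTI mT mY1; case: (m (~` Y)) => [x| |] //.
  by rewrite -EFinD => -[] /eqP; rewrite eq_sym addrC -subr_eq0 addrAC subrr add0r => /eqP ->.
have XY0 : m (X `\` Y) = 0.
  apply/eqP; rewrite -measure_le0 -mC0 le_measure ?inE//.
  - exact: measurableD.
  - exact: measurableC.
by have := measureDI m mX mY; rewrite [X in _ = X + _]XY0 add0e => ->.
Qed.

Section mixed_policy_returns.
Context dS dA (S : measurableType dS) (A : measurableType dA) (R : realType).
Context (p : probability S R) (P : R.-pker (S * A) ~> S).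
Context (D : {mfun S >-> R}) (d : R) (Sreach : set S).
Context (pi pi_rec : R.-pker S ~> A).
Context (mu nu : probability (trajectory S A) R).
Hypotheses (hreach : is_reachable_space p P Sreach) (pD : p (safe_region D d) = 1).
Hypotheses (hmu : is_trajectory_law p P pi mu).
Hypotheses (hnu : is_trajectory_law p P (mixed_policy D d pi pi_rec) nu).

(** Reachability is included because the slack is assumed only at reachable safe states. *)
Let G := safe_region D d `&` Sreach.

Let mG : measurable G.
Proof.
by have [mSr _ _] := hreach; apply: measurableI => //; exact: measurable_safe_region.
Qed.

Lemma safe_stays_le (eta : R) n :
  (0 <= eta)%R -> is_invariance_slack P Sreach D d pi eta ->
  mu (~` stays G n.+1) <= (n%:R * eta)%:E.
Proof.
have [mSr pSr PSr] := hreach.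
have mD := measurable_safe_region D d.
move=> eta0 slack; apply: (probability_stays n hmu) => //.
  by rewrite measureI_full//; exact: probability_setT.
move=> s [sD sSr].
(* From a reachable state the next state is reachable almost surely, so the slack of the safe region
   is also one for [G]. *)
have -> : (pi \; P) s G = (pi \; P) s (safe_region D d).
  rewrite /= /kcomp; apply: eq_integral => a _.
  by rewrite measureI_full ?prob_kernel ?PSr.
by rewrite -leeBlDr// -EFinB; exact: slack.
Qed.

Lemma mixed_agree t X : measurable X ->
  mu (stays G t.+1 `&` (fun w : trajectory S A => (w t : S * A)) @^-1` X) =
  nu (stays G t.+1 `&` (fun w : trajectory S A => (w t : S * A)) @^-1` X).
Proof.
move=> mX; apply: law_stays_agree hmu hnu mG _ mX => s [sD _] /=.
by rewrite /mixed_policy mem_set.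
Qed.

Lemma mixed_return_le (gamma M eta : R) (r : {mfun (S * A)%type >-> R}) :
  (0 < gamma < 1)%R -> (forall x, (`|r x| <= M)%R) ->
  (0 <= eta)%R -> is_invariance_slack P Sreach D d pi eta ->
  `|expected_return gamma r mu - expected_return gamma r nu| <=
  (2 * M * eta / (1 - gamma) ^+ 3)%:E.
Proof.
move=> hgamma rM eta0 slack; apply: expected_return_le => // t.
have mE := measurable_stays (A := A) t.+1 mG.
have mue := safe_stays_le t eta0 slack.
apply: (coupling_integral_le (measurable_coordinate t) mE _ rM (mixed_agree t)) => //.
(* The slack concerns the main policy only. Agreement on the full event shows that staying is
   equally likely under [nu], which transfers the bound. *)
have := mixed_agree t measurableT; rewrite preimage_setT !setIT => eqE.
by move: mue; rewrite !probability_setC// eqE.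
Qed.

End mixed_policy_returns.

(** * The approximate and exact cases *)

Theorem corollary5
  (R : realType) (dS dA : measure_display)
  (S : measurableType dS) (A : measurableType dA)
  (p : probability S R) (P : R.-pker (S * A) ~> S)
  (r : {mfun (S * A)%type >-> R}) (r_max gamma : R)
  (hr : forall s a, (- r_max <= r (s, a) <= r_max)%R)
  (hgamma : (0 < gamma < 1)%R)
  (D : {mfun S >-> R}) (hD : forall s, (0 <= D s)%R)
  (d_max : R) (hd_max : (0 <= d_max)%R)
  (Sreach : set S) (hSreach : is_reachable_space p P Sreach)
  (Theta : Type) (pi : Theta -> R.-pker S ~> A) (pi_rec : R.-pker S ~> A)
  (theta : Theta)
  (p_theta p_mix : probability (trajectory S A) R)
  (hp_theta : is_trajectory_law p P (pi theta) p_theta)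
  (hp_mix :
     is_trajectory_law p P (mixed_policy D d_max (pi theta) pi_rec) p_mix) :
  (Sreach `<=` safe_region D d_max ->
     [/\ {ae p_theta, forall w, forall (t : nat) (C : set A), measurable C ->
            pi theta (state_at t w) C =
            mixed_policy D d_max (pi theta) pi_rec (state_at t w) C},
         out_of_region_rate gamma D p_theta d_max = 0
       & expected_return gamma r p_mix = expected_return gamma r p_theta])
  /\
  (~ (Sreach `<=` safe_region D d_max) ->
     p (safe_region D d_max) = 1 ->
     forall eta_star : R, (0 <= eta_star)%R ->
     is_invariance_slack P Sreach D d_max (pi theta) eta_star ->
     `|expected_return gamma r p_theta - expected_return gamma r p_mix|
       <= (2 * r_max * eta_star / (1 - gamma) ^+ 3)%:E).
Proof.
have rM x : (`|r x| <= r_max)%R by rewrite ler_norml; case: x.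
have [mSr pSr PSr] := hSreach.
have mD := measurable_safe_region D d_max.
split; last first.
  move=> _ pD eta eta0 slack.
  exact: (mixed_return_le hSreach pD hp_theta hp_mix).
move=> SrD.
have sub1 (T : probability S R) : T Sreach = 1 -> T (safe_region D d_max) = 1.
  move=> TSr; apply/eqP; rewrite eq_le probability_le1//= -TSr.
  by rewrite le_measure ?inE.
have pD := sub1 p pSr.
have slack0 : is_invariance_slack P Sreach D d_max (pi theta) 0.
  move=> s sSr _; rewrite subr0 /= /kcomp.
  have -> : 1%:E = \int[pi theta s]_a (cst 1 a) :> \bar R.
    by rewrite integral_cst// mul1e prob_kernel.
  apply: ge0_le_integral => //.
    exact: measurableT_comp (measurable_kernel P _ mD) (measurable_pair1 s).
  by move=> a _; rewrite /= -(PSr s a sSr) le_measure ?inE.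
(* Being unsafe at time [t] violates [stays G t.+1], the first stay event that constrains time [t];
   this failure has mass at most [t * 0]. *)
have unsafe0 t : p_theta [set w | ~ safe_region D d_max (state_at t w)] = 0.
  apply/eqP; rewrite -measure_le0.
  have := safe_stays_le hSreach pD hp_theta t (lexx 0%R) slack0.
  rewrite mulr0; apply: le_trans; rewrite le_measure ?inE//.
  - apply: measurableC; rewrite -[X in measurable X]setTI.
    exact: measurable_state_at.
  - by apply: measurableC; apply: measurable_stays; exact: measurableI.
  - by move=> w /= nD st; apply: nD; have [] := st t (ltnSn t).
split.
- have : {ae p_theta, forall w, forall t, safe_region D d_max (state_at t w)}.
    apply: ae_foralln => t.
    exists [set w | ~ safe_region D d_max (state_at t w)]; split; last by [].
      apply: measurableC; rewrite -[X in measurable X]setTI.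
      exact: measurable_state_at.
    (* Countably many null events, one per time, give safety at all times almost surely. *)
    exact: unsafe0.
  move=> aesafe; apply: filterS aesafe => w safe t C _.
  by rewrite /mixed_policy mem_set.
- rewrite /out_of_region_rate eseries0 ?mule0// => t _ _.
  by rewrite unsafe0 mule0.
(* With zero slack the distance is at most 0; finiteness of both returns turns this into
   equality. *)
- have := mixed_return_le hSreach pD hp_theta hp_mix hgamma rM (lexx 0%R) slack0.
  rewrite mulr0 mul0r.
  have [fin1 _] := cvg_expected_return hgamma rM p_theta.
  have [fin2 _] := cvg_expected_return hgamma rM p_mix.
  rewrite -(fineK fin1) -(fineK fin2) -EFinB abse_EFin lee_fin normr_le0 subr_eq0.
  by move=> /eqP ->.
Qed.
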